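(* Let $q$ be a prime power with $q-1=ml^2$ for integers $l,m\ge 2$. Let $\theta$ be a primitive element of $\mathbb{F}_q$, put $\beta=\theta^l$ and $C=\langle\beta^m\rangle=\langle\theta^{ml}\rangle\le\mathbb{F}_q^*$. Let $\sigma:\mathbb{Z}_m\to\mathbb{Z}_{ml}$ be an injective map, where elements of $\mathbb{Z}_{ml}$ are identified with their representatives in $\{0,\dots,ml-1\}$, and put $D_j=\theta^{\sigma(j)}C$ for $0\le j\le m-1$. Then for any non-empty subset $S\subseteq\{1,\dots,m-1\}$, the family $\{D_0,\dots,D_{m-1}\}$ is a $(q,m,l;|S|)$-$S$-CEDF in $(\mathbb{F}_q,+)$ if and only if every coset of $C$ in $\mathbb{F}_q^*$ contains exactly $|S|$ elements (counted with multiplicity) of the multiset $$\{\{\theta^{\sigma(j+c)}-\theta^{\sigma(j)}\beta^{mr}:\ 0\le j\le m-1,\ 0\le r\le l-1,\ c\in S\}\},$$ where $j+c$ is taken modulo $m$.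
   Context: Let $(G,+)$ be a finite abelian group of order $n$ (written additively), let $l,m\ge 2$, and let $S$ be a non-empty subset of $\{1,\dots,m-1\}$. For non-empty subsets $A,B\subseteq G$, $\Delta(A,B)$ denotes the multiset $\{\{a-b: a\in A, b\in B\}\}$. A family $\{A_0,\dots,A_{m-1}\}$ of $m$ pairwise disjoint subsets of $G$ is an $(n,m,l;\lambda)$-$S$-circular external difference family (CEDF) in $G$ if $|A_i|=l$ for all $i$ and each nonzero $g\in G$ occurs exactly $\lambda$ times in the multiset union $\bigcup_{c\in S}\bigcup_{i=0}^{m-1}\Delta(A_{i+c},A_i)$, where subscripts are taken modulo $m$. *)

(* Defs.v *)
From HB Require Import structures.
From mathcomp Require Import all_boot all_order all_fingroup all_algebra.
From mathcomp Require Import all_solvable all_field.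

Set Implicit Arguments.
Unset Strict Implicit.
Unset Printing Implicit Defensive.

Import GRing.Theory.
Local Open Scope ring_scope.

(* Finite multisets are represented by sequences: the multiplicity of g in s  *)
(* is count_mem g s, and multiset union is concatenation.                     *)

Definition Delta (G : finZmodType) (A B : {set G}) : seq G :=
  [seq a - b | a <- enum A, b <- enum B].

Definition circular_differences (G : finZmodType) (m : nat)
    (S : {set 'Z_m}) (A : 'Z_m -> {set G}) : seq G :=
  \big[cat/[::]]_(c in S) \big[cat/[::]]_(i : 'Z_m) Delta (A (i + c)) (A i).

(* 'Z_m is the ring of integers modulo m only for m > 1, which is part of the *)
(* definition. A subset of {1, ..., m - 1} is a set of nonzero classes.       *)
Record is_CEDF (G : finZmodType) (n m l lambda : nat)
    (S : {set 'Z_m}) (A : 'Z_m -> {set G}) : Prop := IsCEDF {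
  CEDF_order : #|G| = n;
  CEDF_m_ge2 : (2 <= m)%N;
  CEDF_l_ge2 : (2 <= l)%N;
  CEDF_S_nonempty : S != set0;
  CEDF_S_nonzero : 0 \notin S;
  CEDF_disjoint : forall i j : 'Z_m, i != j -> [disjoint A i & A j];
  CEDF_card : forall i : 'Z_m, #|A i| = l;
  CEDF_count : forall g : G, g != 0 ->
    count_mem g (circular_differences S A) = lambda
}.

Section Cyclotomic.

Variables (F : finFieldType) (m l : nat) (theta : {unit F}).

(* The subset of F underlying a set of elements of its multiplicative group.  *)
Definition unit_carrier (X : {set {unit F}}) : {set F} :=
  [set val x | x in X].

Definition beta : {unit F} := (theta ^+ l)%g.

Definition subgroupC : {group {unit F}} := <[beta ^+ m]>%G.

Definition familyD (sigma : 'Z_m -> 'Z_(m * l)) (j : 'Z_m) : {set F} :=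
  unit_carrier ((theta ^+ sigma j)%g *: subgroupC)%g.

Definition shifted_differences (sigma : 'Z_m -> 'Z_(m * l))
    (S : {set 'Z_m}) : seq F :=
  \big[cat/[::]]_(c in S) \big[cat/[::]]_(j : 'Z_m)
    [seq val theta ^+ sigma (j + c)
         - val theta ^+ sigma j * val beta ^+ (m * r) | r : 'I_l].

End Cyclotomic.

(* Main.v *)
Require Import Defs.
From HB Require Import structures.
From mathcomp Require Import all_boot all_order all_fingroup all_algebra.
From mathcomp Require Import all_solvable all_field.

Set Implicit Arguments.
Unset Strict Implicit.
Unset Printing Implicit Defensive.

Import GRing.Theory.
Local Open Scope ring_scope.

(** For cosets [x C] and [y C], each difference [x a - y b'] with [a], [b'] in [C] factors as
    [a (x - y b)] with [b = a^-1 b'] in [C]. For fixed [b] it equals a unit [g] for exactly one [a]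
    if [x - y b] lies in [g C], and for none otherwise ([sum_scale_eq], [count_Delta_lcosets]).
    Summing over [c] and [j], the multiplicity of [g] among the circular differences is the number
    of shifted differences in [g C] ([count_circular_differences_familyD]). As [g] runs over the
    nonzero elements, [g C] runs over all cosets, so the two counting conditions agree. The rest of
    the CEDF definition follows from [C] having order [l] and from the injectivity of [sigma]
    ([disjoint_familyD]). *)

Lemma count_big_cat (T I : Type) (a : pred T) (r : seq I) (P : pred I)
    (f : I -> seq T) :
  count a (\big[cat/[::]]_(i <- r | P i) f i)
    = (\sum_(i <- r | P i) count a (f i))%N.
Proof. exact: (big_morph (count a) (count_cat a)). Qed.

Lemma count_mem_Delta (G : finZmodType) (A B : {set G}) (g : G) :
  count_mem g (Delta A B) = (\sum_(a in A) \sum_(b in B) (a - b == g)%R)%N.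
Proof.
rewrite /Delta count_flatten sumnE !big_map big_enum /=.
by apply: eq_bigr => a _; rewrite -sum1_count big_map big_mkcond big_enum.
Qed.

Lemma sum_cycle (gT : finGroupType) (c : gT) (f : gT -> nat) :
  (\sum_(a in <[c]>%g) f a = \sum_(r < #[c]%g) f (c ^+ r)%g)%N.
Proof.
have -> : <[c]>%g = [set (c ^+ (r : nat))%g | r : 'I_#[c]%g].
  apply/setP => a; apply/idP/imsetP => [/cyclePmin[r lt_r ->]|[r _ ->]].
    by exists (Ordinal lt_r).
  exact: mem_cycle.
rewrite big_imset //= => r s _ _ /eqP.
by rewrite eq_expg_ord // => /eqP.
Qed.

Section UnitCosets.

Variable F : finFieldType.
Implicit Types (C : {group {unit F}}) (x y g : {unit F}).

Lemma big_unit_carrier_lcoset C x (f : F -> nat) :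
  (\sum_(a in unit_carrier (x *: C)%g) f a
    = \sum_(a in C) f (val x * val a)%R)%N.
Proof.
rewrite big_imset /=; last by move=> a b _ _; apply: val_inj.
by rewrite -lcosetE big_imset //= => a b _ _; apply: mulgI.
Qed.

(** The only candidate is [a = z^-1 g], and it lies in [C] exactly when [z] lies in [g C]; for
    [z = 0] both sides vanish. *)
Lemma sum_scale_eq C g (z : F) :
  (\sum_(a in C) (z * val a == val g)%R)%N = (z \in unit_carrier (g *: C)%g).
Proof.
case: imsetP => [[w /lcosetP[c Cc ->] ->]|nz].
  (* Here [z = g c], so [z a = g] forces [a = c^-1]. *)
  rewrite (bigD1 c^-1%g) ?groupV // -FinRing.val_unitM mulgK eqxx.
  rewrite big1 // => a /andP[_ /eqP ne_ac]; apply/eqP; rewrite eqb0.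
  rewrite -FinRing.val_unitM; apply/eqP => /val_inj /(canRL (mulKg _)) eq_a.
  by case: ne_ac; rewrite eq_a invMg mulgKV.
rewrite big1 // => a Ca; apply/eqP; rewrite eqb0; apply/eqP => za.
case: nz; exists (g * a^-1)%g; first by rewrite mem_lcoset mulKg groupV.
rewrite FinRing.val_unitM -za FinRing.val_unitV mulrK //; exact: valP a.
Qed.

(* Substituting b := a * b turns x a - y b = g into a (x - y b) = g. *)
Lemma count_Delta_lcosets C x y g :
  count_mem (val g) (Delta (unit_carrier (x *: C)%g) (unit_carrier (y *: C)%g))
    = (\sum_(b in C) ((val x - val y * val b)%R \in unit_carrier (g *: C)%g))%N.
Proof.
rewrite count_mem_Delta big_unit_carrier_lcoset.
under eq_bigr => a Ca.
  rewrite big_unit_carrier_lcoset (reindex_inj (mulgI a)) /=.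
  under eq_bigl => b do rewrite groupMl //.
  over.
rewrite exchange_big /=; apply: eq_bigr => b _; rewrite -sum_scale_eq.
apply: eq_bigr => a _; rewrite mulrBl -mulrA.
by rewrite [val b * _]mulrC.
Qed.

Lemma card_unit_carrier (X : {set {unit F}}) : #|unit_carrier X| = #|X|.
Proof. exact: (card_imset _ val_inj). Qed.

Lemma disjoint_unit_carrier (X Y : {set {unit F}}) :
  [disjoint X & Y] -> [disjoint unit_carrier X & unit_carrier Y].
Proof.
move=> dXY; rewrite disjoint_subset; apply/subsetP => _ /imsetP[x Xx ->].
by rewrite !inE (mem_imset _ _ val_inj) (disjointFr dXY).
Qed.

End UnitCosets.

Section Cyclotomy.

Variables (F : finFieldType) (m l : nat) (theta : {unit F}).
Variable sigma : 'Z_m -> 'Z_(m * l).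

(** The order hypothesis makes the powers [beta ^+ (m * r)], for [r] below [l], list each element of
    [C] once. *)
Lemma count_circular_differences_familyD (S : {set 'Z_m}) (g : {unit F}) :
    #[beta l theta ^+ m]%g = l ->
  count_mem (val g) (circular_differences S (familyD theta sigma))
    = count [in unit_carrier (g *: subgroupC m l theta)%g]
        (shifted_differences theta sigma S).
Proof.
move=> ord_c; rewrite /circular_differences /shifted_differences.
rewrite !count_big_cat; apply: eq_bigr => c _.
rewrite !count_big_cat; apply: eq_bigr => j _.
rewrite count_Delta_lcosets sum_cycle ord_c -sum1_count big_map.
rewrite [RHS]big_mkcond big_enum /=; apply: eq_bigr => r _.
by rewrite -expgM !FinRing.val_unitX; case: ifP.
Qed.

(** A common element gives two powers of [theta] with exponents [sigma i] and [sigma j] up to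
    multiples of [m * l]. Since [m * l] divides the order of [theta], the two indices agree modulo
    [m * l]. *)
Lemma disjoint_familyD (i j : 'Z_m) :
    (1 < m * l)%N -> (m * l %| #[theta]%g)%N -> injective sigma -> i != j ->
  [disjoint familyD theta sigma i & familyD theta sigma j].
Proof.
move=> ml_gt1 ml_dvd sigma_inj; apply: contraNT => meet_ij.
have: ~~ [disjoint ((theta ^+ sigma i)%g *: subgroupC m l theta)%g
                 & ((theta ^+ sigma j)%g *: subgroupC m l theta)%g].
  by apply: contra meet_ij; apply: disjoint_unit_carrier.
case/pred0Pn => x /andP[/lcosetP[_ /cycleP[u ->] ->]].
case/lcosetP => _ /cycleP[v ->] /eqP.
rewrite -!expgM -!expgD eq_expg_mod_order => /eqP eq_th.
have: sigma i = sigma j %[mod m * l].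
  have := congr1 (modn^~ (m * l)) eq_th.
  rewrite !modn_dvdm // !mulnA [(l * m)%N]mulnC.
  by rewrite ![(_ + m * l * _)%N]addnC ![(m * l * _)%N]mulnC !modnMDl.
(* ['Z_(m * l)] really has modulus [m * l] because [1 < m * l]. *)
have lt_sigma k : (sigma k < m * l)%N by rewrite -[X in (_ < X)%N]Zp_cast.
rewrite !modn_small ?lt_sigma // => eq_sigma.
by apply/eqP/sigma_inj/val_inj.
Qed.

End Cyclotomy.

Theorem theorem4 (p k q m l : nat) (F : finFieldType) (theta : {unit F})
    (sigma : 'Z_m -> 'Z_(m * l)) (S : {set 'Z_m})
    (p_prime : prime p) (k_gt0 : (0 < k)%N) (q_def : q = (p ^ k)%N)
    (F_card : #|F| = q)
    (l_ge2 : (2 <= l)%N) (m_ge2 : (2 <= m)%N)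
    (q_ml : (q - 1)%N = (m * l ^ 2)%N)
    (theta_primitive : generator [set: {unit F}] theta)
    (sigma_inj : injective sigma)
    (S_nonempty : S != set0) (S_nonzero : 0 \notin S) :
  is_CEDF q l #|S| S (familyD theta sigma)
  <->
  (forall X : {set {unit F}},
     X \in lcosets (subgroupC m l theta) [set: {unit F}] ->
     count [in unit_carrier X] (shifted_differences theta sigma S) = #|S|).
Proof.
have ord_theta : #[theta]%g = (m * l ^ 2)%N.
  by rewrite -q_ml -F_card subn1 -card_finField_unit (eqP theta_primitive).
have [l_gt0 m_gt0] : (0 < l /\ 0 < m)%N by split; apply: ltnW.
have ml_dvd : (m * l %| #[theta]%g)%N by rewrite ord_theta -mulnn mulnA dvdn_mulr.
(* [theta ^+ (m * l)] has order [m * l ^ 2] divided by [m * l]. *)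
have ord_c : #[beta l theta ^+ m]%g = l.
  rewrite -expgM [(l * m)%N]mulnC orderXdiv //.
  by rewrite ord_theta -mulnn mulnA mulKn // muln_gt0 m_gt0.
split=> [[_ _ _ _ _ _ _ cnt] X /imsetP[g _ ->]|cnt].
  rewrite lcosetE -count_circular_differences_familyD // cnt //.
  by rewrite -unitfE; exact: valP g.
split=> // [i j ne_ij|i|z].
- apply: disjoint_familyD => //.
  exact: leq_trans m_ge2 (leq_pmulr _ l_gt0).
- by rewrite card_unit_carrier card_lcoset -orderE.
- rewrite -unitfE => z_unit.
  (* Viewing the nonzero [z] as a unit gives the coset [z C] to which [cnt] applies. *)
  rewrite -[z]/(val (FinRing.unit F z_unit)).
  rewrite count_circular_differences_familyD // cnt //.
  by rewrite -lcosetE imset_f ?inE.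
Qed.
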